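(* Let $F:\mathcal{C}\to\mathcal{D}$ be a surjective tensor functor between fusion categories over $\mathbb{C}$. Then $$F(R_{\mathcal{C}})=\frac{\mathrm{FPdim}(\mathcal{C})}{\mathrm{FPdim}(\mathcal{D})}\,R_{\mathcal{D}}.$$
   Context: A fusion category over $\mathbb{C}$ is a $\mathbb{C}$-linear semisimple rigid tensor category with finitely many isomorphism classes of simple objects, finite dimensional Hom spaces, and $\operatorname{End}(\mathbf 1)=\mathbb{C}$. A tensor functor $F:\mathcal{C}\to\mathcal{D}$ (unital, $\mathbb{C}$-linear, monoidal) is surjective if every simple object of $\mathcal{D}$ is contained in an object of the form $F(T)$, $T\in\mathcal{C}$. For an object $X$, $\mathrm{FPdim}(X)$ is the largest positive eigenvalue of the matrix of multiplication by $X$ in the Grothendieck ring $K(\mathcal{C})$ with respect to the basis of simple objects. $\mathrm{FPdim}(\mathcal{C})=\sum_{X\in\mathrm{Irr}(\mathcal{C})}\mathrm{FPdim}(X)^2$, where $\mathrm{Irr}(\mathcal{C})$ is the set of isomorphism classes of simple objects. The regular (virtual) object is $R_{\mathcal{C}}=\sum_{X\in\mathrm{Irr}(\mathcal{C})}\mathrm{FPdim}(X)\,X\in K(\mathcal{C})\otimes_{\mathbb{Z}}\mathbb{R}$; $F$ acts on such virtual objects through the induced map $K(\mathcal{C})\otimes\mathbb{R}\to K(\mathcal{D})\otimes\mathbb{R}$. *)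

(* Defs.v *)
From HB Require Import structures.
From mathcomp Require Import all_boot all_order all_algebra.
From mathcomp Require Import complex.
From mathcomp Require Import boolp classical_sets reals.

Set Implicit Arguments.
Unset Strict Implicit.
Unset Printing Implicit Defensive.

Import Order.TTheory GRing.Theory Num.Theory.
Local Open Scope ring_scope.

Declare Scope cat_scope.
Delimit Scope cat_scope with cat.
Local Open Scope cat_scope.

Reserved Notation "g ∘ f" (at level 40, left associativity).
Reserved Notation "X ⊗ Y" (at level 38, left associativity).
Reserved Notation "f ⊠ g" (at level 38, left associativity).

(** * K-linear categories *)

(* Hom-spaces are [vectType]s, that is, finite dimensional K-vector spaces. *)
Record linear_category (K : fieldType) := LinearCategory {
  obj :> Type;
  hom : obj -> obj -> vectType K;
  idm : forall X, hom X X;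
  mcomp : forall X Y Z, hom Y Z -> hom X Y -> hom X Z;
  comp1m : forall X Y (f : hom X Y), mcomp (idm Y) f = f;
  compm1 : forall X Y (f : hom X Y), mcomp f (idm X) = f;
  compA : forall W X Y Z (h : hom Y Z) (g : hom X Y) (f : hom W X),
    mcomp h (mcomp g f) = mcomp (mcomp h g) f;
  comp_linear_r : forall X Y Z (g : hom Y Z),
    linear (fun f : hom X Y => mcomp g f);
  comp_linear_l : forall X Y Z (f : hom X Y),
    linear (fun g : hom Y Z => mcomp g f)
}.

Arguments hom {K l} X Y.
Arguments idm {K l} X.
Arguments mcomp {K l X Y Z} g f.

Notation "g ∘ f" := (mcomp g f) : cat_scope.

Section LinearCategory.
Variables (K : fieldType) (C : linear_category K).
Implicit Types X Y Z : C.

Record iso X Y := Iso {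
  isof : hom X Y;
  isoV : hom Y X;
  isofK : isoV ∘ isof = idm X;
  isoVK : isof ∘ isoV = idm Y
}.

Definition isomorphic X Y : Prop := inhabited (iso X Y).

Definition is_iso X Y (f : hom X Y) : Prop :=
  exists g : hom Y X, g ∘ f = idm X /\ f ∘ g = idm Y.

Definition is_mono X Y (f : hom X Y) : Prop :=
  forall W (g h : hom W X), f ∘ g = f ∘ h -> g = h.

Definition is_epi X Y (f : hom X Y) : Prop :=
  forall Z (g h : hom Y Z), g ∘ f = h ∘ f -> g = h.

Definition is_kernel X Y Z (f : hom Y Z) (k : hom X Y) : Prop :=
  f ∘ k = 0 /\
  forall W (g : hom W Y), f ∘ g = 0 -> exists! u : hom W X, k ∘ u = g.

Definition is_cokernel X Y Z (f : hom X Y) (q : hom Y Z) : Prop :=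
  q ∘ f = 0 /\
  forall W (g : hom Y W), g ∘ f = 0 -> exists! u : hom Z W, u ∘ q = g.

Definition zero_object X : Prop :=
  forall Y, (forall f : hom X Y, f = 0) /\ (forall f : hom Y X, f = 0).

(* B is a biproduct of the finite family S; a zero object when n = 0. *)
Definition direct_sum n (S : 'I_n -> C) (B : C) : Prop :=
  exists (inj : forall k, hom (S k) B) (prj : forall k, hom B (S k)),
    [/\ forall k, prj k ∘ inj k = idm (S k),
        forall k l, k != l -> prj l ∘ inj k = 0 &
        \sum_(k < n) inj k ∘ prj k = idm B].

Definition simple_object X : Prop :=
  ~ zero_object X /\
  forall Y (m : hom Y X), is_mono m -> zero_object Y \/ is_iso m.

End LinearCategory.

Definition abelian_category (K : fieldType) (C : linear_category K) : Prop :=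
  (forall n (S : 'I_n -> C), exists B : C, direct_sum S B) /\
  [/\ forall (Y Z : C) (f : hom Y Z),
        exists (X : C) (k : hom X Y), is_kernel f k,
      forall (X Y : C) (f : hom X Y),
        exists (Z : C) (q : hom Y Z), is_cokernel f q,
      forall (X Y : C) (m : hom X Y),
        is_mono m -> exists (Z : C) (f : hom Y Z), is_kernel f m &
      forall (Y Z : C) (e : hom Y Z),
        is_epi e -> exists (X : C) (f : hom X Y), is_cokernel f e].

Definition all_objects_semisimple (K : fieldType) (C : linear_category K) :
    Prop :=
  forall X : C, exists n, exists S : 'I_n -> C,
    (forall k, simple_object (S k)) /\ direct_sum S X.

(** * Tensor categories *)

Record tensor_category (K : fieldType) := TensorCategory {
  tcat :> linear_category K;
  tens : tcat -> tcat -> tcat;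
  tensm : forall (X X' Y Y' : tcat),
    hom X X' -> hom Y Y' -> hom (tens X Y) (tens X' Y');
  tens1m : forall X Y, tensm (idm X) (idm Y) = idm (tens X Y);
  tens_comp : forall X X' X'' Y Y' Y''
      (f' : hom X' X'') (f : hom X X') (g' : hom Y' Y'') (g : hom Y Y'),
    tensm (f' ∘ f) (g' ∘ g) = tensm f' g' ∘ tensm f g;
  tens_linear_r : forall X X' Y Y' (f : hom X X'),
    linear (fun g : hom Y Y' => tensm f g);
  tens_linear_l : forall X X' Y Y' (g : hom Y Y'),
    linear (fun f : hom X X' => tensm f g);
  tunit : tcat;
  assoc : forall X Y Z, iso (tens (tens X Y) Z) (tens X (tens Y Z));
  lunit : forall X, iso (tens tunit X) X;
  runit : forall X, iso (tens X tunit) X;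
  assoc_nat : forall X X' Y Y' Z Z'
      (f : hom X X') (g : hom Y Y') (h : hom Z Z'),
    isof (assoc X' Y' Z') ∘ tensm (tensm f g) h =
    tensm f (tensm g h) ∘ isof (assoc X Y Z);
  lunit_nat : forall X X' (f : hom X X'),
    isof (lunit X') ∘ tensm (idm tunit) f = f ∘ isof (lunit X);
  runit_nat : forall X X' (f : hom X X'),
    isof (runit X') ∘ tensm f (idm tunit) = f ∘ isof (runit X);
  pentagon : forall W X Y Z,
    tensm (idm W) (isof (assoc X Y Z)) ∘ isof (assoc W (tens X Y) Z)
      ∘ tensm (isof (assoc W X Y)) (idm Z) =
    isof (assoc W X (tens Y Z)) ∘ isof (assoc (tens W X) Y Z);
  triangle : forall X Y,
    tensm (idm X) (isof (lunit Y)) ∘ isof (assoc X tunit Y) =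
    tensm (isof (runit X)) (idm Y)
}.

Arguments tens {K t} X Y.
Arguments tensm {K t X X' Y Y'} f g.
Arguments tunit {K t}.
Arguments assoc {K t} X Y Z.
Arguments lunit {K t} X.
Arguments runit {K t} X.

Notation "X ⊗ Y" := (tens X Y) : cat_scope.
Notation "f ⊠ g" := (tensm f g) : cat_scope.

Section Rigidity.
Variables (K : fieldType) (C : tensor_category K).

(* Z is a left dual of X; equivalently X is a right dual of Z. *)
Definition dual_pair (Z X : C) : Prop :=
  exists (ev : hom (Z ⊗ X) tunit) (coev : hom tunit (X ⊗ Z)),
    isof (runit X) ∘ (idm X ⊠ ev) ∘ isof (assoc X Z X) ∘ (coev ⊠ idm X) =
      isof (lunit X) /\
    isof (lunit Z) ∘ (ev ⊠ idm Z) ∘ isoV (assoc Z X Z) ∘ (idm Z ⊠ coev) =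
      isof (runit Z).

Definition rigid : Prop :=
  forall X : C, (exists Z, dual_pair Z X) /\ (exists Z, dual_pair X Z).

End Rigidity.

Record tensor_functor (K : fieldType) (C D : tensor_category K) :=
    TensorFunctor {
  fobj :> C -> D;
  fmap : forall X Y : C, hom X Y -> hom (fobj X) (fobj Y);
  fmap_linear : forall X Y, linear (@fmap X Y);
  fmap1 : forall X, fmap (idm X) = idm (fobj X);
  fmap_comp : forall X Y Z (g : hom Y Z) (f : hom X Y),
    fmap (g ∘ f) = fmap g ∘ fmap f;
  ften : forall X Y : C, iso (fobj X ⊗ fobj Y) (fobj (X ⊗ Y));
  funit : iso tunit (fobj tunit);
  ften_nat : forall X X' Y Y' (f : hom X X') (g : hom Y Y'),
    fmap (f ⊠ g) ∘ isof (ften X Y) = isof (ften X' Y') ∘ (fmap f ⊠ fmap g);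
  ften_assoc : forall X Y Z,
    fmap (isof (assoc X Y Z)) ∘ isof (ften (X ⊗ Y) Z)
      ∘ (isof (ften X Y) ⊠ idm (fobj Z)) =
    isof (ften X (Y ⊗ Z)) ∘ (idm (fobj X) ⊠ isof (ften Y Z))
      ∘ isof (assoc (fobj X) (fobj Y) (fobj Z));
  ften_lunit : forall X,
    fmap (isof (lunit X)) ∘ isof (ften tunit X)
      ∘ (isof funit ⊠ idm (fobj X)) = isof (lunit (fobj X));
  ften_runit : forall X,
    fmap (isof (runit X)) ∘ isof (ften X tunit)
      ∘ (idm (fobj X) ⊠ isof funit) = isof (runit (fobj X))
}.

Definition surjective_functor (K : fieldType) (C D : tensor_category K)
    (F : tensor_functor C D) : Prop :=
  forall Y : D, simple_object Y -> exists (T : C) (m : hom Y (F T)), is_mono m.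

(** * Fusion categories *)

(* The finitely many isomorphism classes of simple objects are given by a
   complete irredundant system of representatives [irr]. *)
Record fusion_category (K : fieldType) := FusionCategory {
  fcat :> tensor_category K;
  fusion_abelian : abelian_category fcat;
  fusion_semisimple : all_objects_semisimple fcat;
  fusion_rigid : rigid fcat;
  fusion_End_unit : bijective (fun c : K => c *: idm (tunit : fcat));
  rank : nat;
  irr : 'I_rank -> fcat;
  irr_simple : forall i, simple_object (irr i);
  irr_inj : forall i j, isomorphic (irr i) (irr j) -> i = j;
  irr_complete : forall X : fcat, simple_object X -> exists i, isomorphic X (irr i)
}.

Arguments irr {K f} i.

Section Multiplicity.
Variables (K : fieldType) (C : fusion_category K).

Definition decomp_size (X : C) : nat := sval (cid (fusion_semisimple X)).

Definition decomp (X : C) : 'I_(decomp_size X) -> C :=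
  sval (cid (svalP (cid (fusion_semisimple X)))).

(* The number of summands isomorphic to [irr i] in a (chosen) decomposition of
   X into simple objects; by Krull-Schmidt it does not depend on the choice. *)
Definition multiplicity (X : C) (i : 'I_(rank C)) : nat :=
  #|[set k | `[< isomorphic (@decomp X k) (irr i) >]]|%SET.

End Multiplicity.

Section FrobeniusPerron.
Variables (R : realType) (C : fusion_category R[i]).

(* K(C) ⊗ R is 'rV[R]_(rank C): by semisimplicity K(C) is the free abelian group
   on the isomorphism classes of simple objects, and vectors are written in
   this basis. *)
Definition groth_class (X : C) : 'rV[R]_(rank C) :=
  \row_(i < rank C) (multiplicity X i)%:R.

(* The R-bilinear extension of [X] [Y] = [X ⊗ Y]. *)
Definition groth_mul (v w : 'rV[R]_(rank C)) : 'rV[R]_(rank C) :=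
  \sum_(i < rank C) \sum_(j < rank C)
    (v 0 i * w 0 j) *: groth_class (irr i ⊗ irr j).

(* Row j holds the coordinates of the product of [X] and [irr j]. *)
Definition mul_matrix (X : C) : 'M[R]_(rank C) := lin1_mx (groth_mul (groth_class X)).

(* A matrix has finitely many eigenvalues, so this supremum is a maximum
   as soon as there is a positive eigenvalue. *)
Definition FPdim (X : C) : R :=
  sup [set a : R | 0 < a /\ eigenvalue (mul_matrix X) a]%classic.

Definition FPdim_cat : R := \sum_(i < rank C) FPdim (irr i) ^+ 2.

Definition regular_object : 'rV[R]_(rank C) :=
  \sum_(i < rank C) FPdim (irr i) *: groth_class (irr i).

End FrobeniusPerron.

(* The R-linear map sending the basis vector of [irr i] to [F (irr i)]. *)
Definition groth_map (R : realType) (C D : fusion_category R[i])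
    (F : tensor_functor C D) (v : 'rV[R]_(rank C)) : 'rV[R]_(rank D) :=
  \sum_(i < rank C) v 0 i *: groth_class (F (irr i)).

(* Main.v *)
Require Import Defs.
From HB Require Import structures.
From mathcomp Require Import all_boot all_order all_algebra.
From mathcomp Require Import complex.
From mathcomp Require Import boolp classical_sets reals.
From mathcomp Require Import topology normedtype derive.
Import Defs.

(** The image v of the regular object of C and the regular object of D are
    eigenvectors of the same strictly positive matrix, and Perron-Frobenius
    theory leaves only one such line.

    In detail, the regular object of a fusion category spans an eigenline of
    every multiplication operator, with eigenvalue FPdim(X) for [X]
    ([regular_object_eigen]).  Two ingredients give this.  The
    Frobenius-Perron dimension is a character of the Grothendieck ring: the
    Perron eigenvector r of right multiplication by the sum of all simple
    objects is, by associativity and uniqueness, an eigenvector of every left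
    multiplication, and a positive eigenvector can only belong to the largest
    eigenvalue, so that [X] r = FPdim(X) r ([FP_eigenvector],
    [fpdim_ext_mul]).  Duality Hom(X ⊗ Y, W) = Hom(Y, X* ⊗ W) makes
    multiplication by X* the transpose of multiplication by X
    ([mul_matrix_dual]); hence the column of dimensions, an eigenvector of all
    multiplication matrices since FPdim is a character, is also an eigenvector
    of their transposes, which is the claim.

    The functor induces a ring homomorphism of Grothendieck rings
    ([groth_map_mul]), so [F X] v = FPdim(X) v for every X in C.  Surjectivity
    makes v strictly positive, whence FPdim(F X) = FPdim(X), and makes the sum
    of the operators [F X], for X simple, strictly positive: every simple
    object of D occurs in some F X, and for simple Y, Y' some product
    Y'' ⊗ Y contains Y' ([transitive_left]).  Both v and the regular object of
    D are eigenvectors of this sum for the same eigenvalue, so they are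
    proportional; applying the linear extension of FPdim, which F preserves,
    yields the constant.

    Grothendieck classes enter through dimensions of Hom-spaces: by Schur's
    lemma the multiplicity of a simple object S in X is dim Hom(S, X), and also
    dim Hom(X, S).  A linear functor preserves direct sums, so its effect on
    classes is determined by its values on simple objects
    ([groth_class_functor]).  This one fact, used for X ⊗ -, - ⊗ Y and F, gives
    the multiplicativity of classes and the compatibility with F. *)

Set Implicit Arguments.
Unset Strict Implicit.
Unset Printing Implicit Defensive.

Import numFieldNormedType.Exports.
Import Order.TTheory GRing.Theory Num.Theory.
Local Open Scope ring_scope.
Local Open Scope cat_scope.

(** * Perron-Frobenius theory of positive matrices *)

Lemma min_ratio (R : realFieldType) n (r v : 'rV[R]_n.+1) :
  (forall i, 0 < r 0 i) ->
  exists c, (forall i, c * r 0 i <= v 0 i) /\ exists i, v 0 i = c * r 0 i.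
Proof.
move=> r_gt0; pose q i := v 0 i / r 0 i.
case: (@Order.TotalTheory.arg_minP _ _ 'I_n.+1 ord0 xpredT q) => // i0 _ min_q.
exists (q i0); split; last by exists i0; rewrite divfK ?gt_eqF.
by move=> i; rewrite -ler_pdivlMr // min_q.
Qed.

(** A positive eigenvector bounds the spectrum: if t is the least number with
    |v| <= t r, then |v| and t r agree at some coordinate, and reading
    |a| |v| <= |v| A <= t r A = b t r there gives |a| <= b. *)
Lemma eigenvalue_le (R : realFieldType) n (A : 'M[R]_n) (r v : 'rV[R]_n) a b :
    (forall i j, 0 <= A i j) -> (forall i, 0 < r 0 i) ->
    r *m A = b *: r -> v != 0 -> v *m A = a *: v -> a <= b.
Proof.
case: n => [|n] in A r v * => A_ge0 r_gt0 rA v_neq0 vA.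
  by rewrite [v]thinmx0 eqxx in v_neq0.
(* The least upper ratio of |v| to r is minus the least ratio of -|v| to r. *)
have [c [c_le [i0 Ec]]] := @min_ratio _ _ r (- map_mx Num.norm v) r_gt0.
have {}c_le i : `|v 0 i| <= (- c) * r 0 i.
  by rewrite mulNr lerNr; move: (c_le i); rewrite !mxE.
have {}Ec : `|v 0 i0| = (- c) * r 0 i0.
  by rewrite mulNr -Ec !mxE opprK.
have v0_gt0 : 0 < `|v 0 i0|.
  rewrite lt_neqAle normr_ge0 andbT eq_sym.
  apply: contra v_neq0 => /eqP v0; apply/eqP/rowP => i; rewrite !mxE.
  have c0 : - c = 0.
    by apply/eqP; move/eqP: Ec; rewrite v0 eq_sym mulf_eq0 (gt_eqF (r_gt0 _)) orbF.
  by apply/eqP; rewrite -normr_eq0 eq_le normr_ge0 andbT -(mul0r (r 0 i)) -c0.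
rewrite -(ler_pM2r v0_gt0) (le_trans (ler_wpM2r (ltW v0_gt0) (ler_norm a))) //.
have /rowP/(_ i0) := vA; rewrite !mxE -normrM => <-.
apply: le_trans (ler_norm_sum _ _ _) _.
rewrite Ec mulrCA; have /rowP/(_ i0) := rA; rewrite !mxE => <-.
rewrite mulr_sumr ler_sum // => j _.
by rewrite normrM (ger0_norm (A_ge0 _ _)) mulrA ler_wpM2r.
Qed.

(** Subtract from v the largest multiple of r that keeps it nonnegative: the
    difference has a zero coordinate, but the image of a nonzero nonnegative
    vector under a positive matrix has none. *)
Lemma positive_eigenvector_unique (R : realFieldType) n (A : 'M[R]_n)
    (r v : 'rV[R]_n) a :
    (forall i j, 0 < A i j) -> (forall i, 0 < r 0 i) ->
    r *m A = a *: r -> v *m A = a *: v -> exists c, v = c *: r.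
Proof.
case: n => [|n] in A r v * => A_gt0 r_gt0 rA vA.
  by exists 0; rewrite [v]thinmx0 [r]thinmx0 scaler0.
have [c [c_le [i0 Ec]]] := @min_ratio _ _ r v r_gt0.
exists c; apply/rowP => j; rewrite !mxE; apply/eqP; rewrite -subr_eq0.
have wA : (v - c *: r) *m A = a *: (v - c *: r).
  by rewrite mulmxBl vA -scalemxAl rA scalerBr !scalerA mulrC.
have /rowP/(_ i0)/eqP := wA.
rewrite [in X in _ == X]mxE [(v - c *: r) 0 i0]mxE Ec !mxE subrr mulr0.
rewrite psumr_eq0 => [/allP/(_ j)|i _].
  by rewrite mem_index_enum !mxE mulf_eq0 (gt_eqF (A_gt0 _ _)) orbF; apply.
by rewrite !mxE mulr_ge0 ?subr_ge0 // ltW.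
Qed.

(** Collatz and Wielandt: among the pairs (x, l) with x in the simplex and
    l x <= x A, which form a compact set, take one with l maximal.  If x A were
    not equal to l x, then the nonzero nonnegative vector x A - l x would have a
    strictly positive image under A, so that y = x A would satisfy
    (l + e) y <= y A for some e > 0. *)
Lemma perron_exists (R : realType) n (A : 'M[R]_n) :
    (0 < n)%N -> (forall i j, 0 < A i j) ->
  exists (r : 'rV_n) a, (forall i, 0 < r 0 i) /\ r *m A = a *: r.
Proof.
case: n => [//|n] in A * => _ A_gt0.
pose S (x : 'rV[R]_n.+1) := \sum_i x 0 i.
pose E := [set p : 'rV[R]_n.+1 * R | [/\ forall i, 0 <= p.1 0 i, S p.1 = 1,
  0 <= p.2 & forall i, p.2 * p.1 0 i <= (p.1 *m A) 0 i]]%classic.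
have le1 (x : 'rV_n.+1) : (forall i, 0 <= x 0 i) -> S x = 1 -> forall i, x 0 i <= 1.
  move=> x_ge0 <- i; rewrite /S (bigD1 i) //= lerDl sumr_ge0 //.
pose L := \sum_i \sum_j A j i.
have posA (x : 'rV_n.+1) : (forall i, 0 <= x 0 i) -> x != 0 ->
    forall i, 0 < (x *m A) 0 i.
  move=> x_ge0 /rV0Pn[k xk] i; rewrite mxE (bigD1 k) //=.
  apply: ltr_wpDr; last by rewrite mulr_gt0 // lt_neqAle eq_sym xk x_ge0.
  by apply: sumr_ge0 => j _; rewrite mulr_ge0 // ltW.
have S_neq0 x : S x = 1 -> x != 0.
  apply: contra_eqN => /eqP ->; rewrite /S big1 ?(eq_sym 0) ?oner_eq0 //.
  by move=> i _; rewrite mxE.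
have compactE : compact E.
  apply: (@subclosed_compact _ _
    ([set x : 'rV[R]_n.+1 | forall i, `[0, 1]%classic (x ord0 i)] `*`
      `[0, L])%classic).
  - have -> : E = ((\bigcap_i [set p : 'rV[R]_n.+1 * R | 0 <= p.1 0 i]) `&`
      [set p : 'rV[R]_n.+1 * R | S p.1 = 1] `&` [set p : 'rV[R]_n.+1 * R | 0 <= p.2] `&`
      (\bigcap_i [set p : 'rV[R]_n.+1 * R | p.2 * p.1 0 i <= (p.1 *m A) 0 i]))%classic.
      apply/seteqP; split => [p [p1 p2 p3 p4]|p [[[p1 p2] p3] p4]].
        by split=> [|i _]; [split=> //; split=> // i _; exact: p1|exact: p4].
      by split=> // i; [exact: p1|exact: p4].
    have cc i : continuous (fun p : 'rV[R]_n.+1 * R => p.1 0 i).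
      move=> p; apply: (@continuous_comp _ _ _ fst (fun x : 'rV_n.+1 => x 0 i)).
        exact: cvg_fst.
      exact: coord_continuous.
    have cS : continuous (fun p : 'rV[R]_n.+1 * R => S p.1).
      by apply: continuous_big => [p|i _]; [exact: add_continuous|exact: cc].
    have cd i : continuous
        (fun p : 'rV[R]_n.+1 * R => (p.1 *m A) 0 i - p.2 * p.1 0 i).
      move=> p; apply: cvgB.
        under eq_fun do rewrite mxE; rewrite mxE.
        apply: cvg_big => [q|j _]; first exact: add_continuous.
        by apply: cvgM; [exact: cc|exact: cvg_cst].
      by apply: cvgM; [exact: cvg_snd|exact: cc].
    have cl (f : 'rV[R]_n.+1 * R -> R) B :
        continuous f -> closed B -> closed (f @^-1` B)%classic.
      by move=> cf; apply: preimage_closed => p _; exact: cf.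
    apply: closedI; last first.
      apply: closed_bigI => i _; under eq_set do rewrite -subr_ge0.
      exact: (cl _ _ (cd i) (@closed_ge R 0)).
    apply: closedI; last by apply: (cl snd _ _ (@closed_ge R 0)) => p; exact: cvg_snd.
    apply: closedI; last exact: (cl _ _ cS (@closed_eq R 1)).
    apply: closed_bigI => i _; exact: (cl _ _ (cc i) (@closed_ge R 0)).
  - apply: compact_setX; last exact: segment_compact.
    exact: (@rV_compact R _ (fun=> `[0, 1]%classic) (fun=> @segment_compact R 0 1)).
  - move=> [x l] [/= x_ge0 Sx l_ge0 lx]; split => /=.
      by move=> i; rewrite in_itv /= x_ge0 le1.
    (* Summing l x <= x A over the coordinates bounds l by L. *)
    rewrite in_itv /= l_ge0 -[l]mulr1 -Sx mulr_sumr /L ler_sum // => i _.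
    rewrite (le_trans (lx i)) // mxE ler_sum // => j _.
    by rewrite ler_piMl ?le1 // ltW.
have E0 : (E !=set0)%classic.
  pose x : 'rV[R]_n.+1 := delta_mx 0 ord0.
  have x_ge0 i : 0 <= x 0 i by rewrite mxE ler0n.
  exists (x, 0); split => //=.
    rewrite /S (bigD1 ord0) //= mxE !eqxx big1 ?addr0 // => i /negPf ni.
    by rewrite mxE ni andbF.
  move=> i; rewrite mul0r mxE sumr_ge0 // => j _.
  by rewrite mulr_ge0 // ltW.
have snd_cont : {within E, continuous (@snd 'rV[R]_n.+1 R)}%classic.
  by apply: continuous_subspaceT => p; exact: cvg_snd.
have [[x l] /set_mem [/= x_ge0 Sx l_ge0 lx] max_l] :=
  compact_EVT_max E0 compactE snd_cont.
pose y := x *m A.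
have y_gt0 : forall i, 0 < y 0 i := posA x x_ge0 (S_neq0 x Sx).
have yE : y = l *: x; last first.
  exists y, l; split=> //; by rewrite {1}yE -scalemxAl.
apply/eqP; rewrite -subr_eq0; apply/negPn/negP => w_neq0.
have w_ge0 i : 0 <= (y - l *: x) 0 i.
  by rewrite [leRHS]mxE [X in _ + X]mxE [X in - X]mxE subr_ge0 lx.
have wA_gt0 := posA _ w_ge0 w_neq0.
have [e [e_le [i0 Ee]]] := @min_ratio _ _ y ((y - l *: x) *m A) y_gt0.
have e_gt0 : 0 < e by rewrite -(pmulr_lgt0 _ (y_gt0 i0)) -Ee.
have s_gt0 : 0 < S y.
  by rewrite /S big_ord_recl ltr_wpDr // sumr_ge0 // => i _; exact: ltW.
(* The pair (y / S y, l + e) lies in E, against the maximality of l. *)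
have : l + e <= l.
  apply: (max_l ((S y)^-1 *: y, l + e)); apply/mem_set; split=> /=.
  - by move=> i; rewrite mxE mulr_ge0 ?invr_ge0 // ltW.
  - rewrite /S; under eq_bigr do rewrite mxE.
    by rewrite -mulr_sumr mulVf // gt_eqF.
  - by rewrite addr_ge0 // ltW.
  - move=> i; rewrite -scalemxAl [leRHS]mxE [X in _ * X <= _]mxE mulrCA.
    rewrite ler_pM2l ?invr_gt0 // mulrDl.
    have := e_le i; rewrite mulmxBl -scalemxAl -/y.
    by rewrite [leRHS]mxE [X in _ + X]mxE [X in - X]mxE lerBrDl.
by rewrite gerDl leNgt e_gt0.
Qed.

(** * Dimensions of Hom-spaces *)

(** The structural maps of a linear category come with bare proofs of
    linearity; packing gives access to the theory of linear maps. *)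
Definition pack_linear (K : fieldType) (U V : lmodType K) (f : U -> V)
    (lf : linear f) : {linear U -> V} :=
  HB.pack f (GRing.isLinear.Build K U V *:%R f lf).

Section LinearMaps.
Variables (K : fieldType) (U V : vectType K) (f : U -> V).
Hypothesis lf : linear f.

Lemma lin0 : f 0 = 0.
Proof. exact: (linear0 (pack_linear lf)). Qed.

Lemma lin_sum I (r : seq I) P (F : I -> U) :
  f (\sum_(i <- r | P i) F i) = \sum_(i <- r | P i) f (F i).
Proof. exact: (linear_sum (pack_linear lf)). Qed.

Lemma linB u v : f (u - v) = f u - f v.
Proof. exact: (linearB (pack_linear lf)). Qed.

Lemma linZ a u : f (a *: u) = a *: f u.
Proof. exact: (linearZ_LR (pack_linear lf)). Qed.

Lemma dim_leq_injective : injective f -> (dim U <= dim V)%N.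
Proof.
move=> f_inj; pose g := linfun (pack_linear lf).
have /eqP kerg : lker g == 0%VS.
  by apply/lker0P => u v; rewrite !lfunE; exact: f_inj.
by rewrite -!dimvf -(@limg_dim_eq _ _ _ g) ?dimvS ?subvf // kerg capv0.
Qed.

End LinearMaps.

Lemma dim_eq0P (K : fieldType) (V : vectType K) :
  reflect (forall v : V, v = 0) (dim V == 0%N).
Proof.
rewrite -dimvf dimv_eq0; apply: (iffP eqP) => [V0 v|V0].
  by apply/eqP; rewrite -memv0 -V0 memvf.
by apply/vspaceP => v; rewrite (V0 v) !mem0v.
Qed.

(** The images of the injections a k span V because the a k (b k v) sum to v, and
    are independent because b k recovers the k-th component of a sum. *)
Lemma dim_biproduct (K : fieldType) (V : vectType K) n
    (U : 'I_n -> vectType K) (a : forall k, U k -> V) (b : forall k, V -> U k) :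
    (forall k, linear (a k)) -> (forall k, linear (b k)) ->
    (forall k, cancel (a k) (b k)) ->
    (forall k l, k != l -> forall u, b l (a k u) = 0) ->
    (forall v, \sum_k a k (b k v) = v) ->
  dim V = (\sum_k dim (U k))%N.
Proof.
move=> la lb abK ab0 sum_ab.
pose im k := limg (linfun (pack_linear (la k))).
have dim_im k : \dim (im k) = dim (U k).
  rewrite -dimvf limg_dim_eq // (_ : lker _ = 0%VS) ?capv0 //; apply/eqP/lker0P.
  by move=> u v; rewrite !lfunE; exact: (can_inj (abK k)).
have -> : dim V = \dim (\sum_k im k).
  rewrite -dimvf; congr (\dim _); apply/esym/eqP; rewrite eqEsubv subvf.
  apply/subvP => v _; rewrite -(sum_ab v); apply: memv_sumr => k _.
  by have := memv_img (linfun (pack_linear (la k))) (memvf (b k v)); rewrite lfunE.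
under [RHS]eq_bigr do rewrite -dim_im.
apply/directvP/directv_sum_independent => u im_u sum_u k _.
have Eu l : u l = a l (b l (u l)).
  by have /memv_imgP[x _] := im_u l isT; rewrite lfunE /= => ->; rewrite abK.
suff b0 : b k (u k) = 0 by rewrite Eu b0 (lin0 (la k)).
have /(congr1 (b k)) := sum_u; rewrite (lin_sum (lb k)) (lin0 (lb k)).
by rewrite (bigD1 k) //= big1 ?addr0 // => l lk; rewrite Eu ab0.
Qed.

Section LinearCategories.
Variables (K : fieldType) (C : linear_category K).
Implicit Types X Y Z : C.

Lemma comp0m X Y Z (f : hom X Y) : (0 : hom Y Z) ∘ f = 0.
Proof. exact: (lin0 (comp_linear_l f)). Qed.

Lemma compm0 X Y Z (g : hom Y Z) : g ∘ (0 : hom X Y) = 0.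
Proof. exact: (lin0 (comp_linear_r g)). Qed.

Lemma compm_suml X Y Z n (g : 'I_n -> hom Y Z) (f : hom X Y) :
  (\sum_k g k) ∘ f = \sum_k g k ∘ f.
Proof. exact: (lin_sum (comp_linear_l f)). Qed.

Lemma compm_sumr X Y Z n (g : hom Y Z) (f : 'I_n -> hom X Y) :
  g ∘ (\sum_k f k) = \sum_k g ∘ f k.
Proof. exact: (lin_sum (comp_linear_r g)). Qed.

Lemma isomorphic_refl X : isomorphic X X.
Proof. by split; exists (idm X) (idm X); rewrite comp1m. Qed.

Definition iso_inv X Y (f : iso X Y) : iso Y X :=
  Iso (isoVK f) (isofK f).

Lemma isomorphic_sym X Y : isomorphic X Y -> isomorphic Y X.
Proof. by case=> f; split; exact: iso_inv f. Qed.

Lemma isomorphic_trans X Y Z :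
  isomorphic X Y -> isomorphic Y Z -> isomorphic X Z.
Proof.
case=> -[f f' fK f'K] [[g g' gK g'K]]; split; exists (g ∘ f) (f' ∘ g').
  by rewrite compA -(compA f') gK compm1.
by rewrite compA -(compA g) f'K compm1.
Qed.

Lemma is_iso_isomorphic X Y (f : hom X Y) : is_iso f -> isomorphic X Y.
Proof. by case=> g [fK gK]; split; exists f g. Qed.

Lemma iso_monic X Y (f : iso X Y) : is_mono (isof f).
Proof.
by move=> W g h /(congr1 (mcomp (isoV f))); rewrite !compA isofK !comp1m.
Qed.

Lemma iso_epic X Y (f : iso X Y) : is_epi (isof f).
Proof.
by move=> Z g h /(congr1 (mcomp^~ (isoV f))); rewrite -!compA isoVK !compm1.
Qed.

Lemma zero_objectP X : zero_object X <-> idm X = 0.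
Proof.
split=> [/(_ X)[]// | X0 Y]; split=> f.
  by rewrite -[f]compm1 X0 compm0.
by rewrite -[f]comp1m X0 comp0m.
Qed.

Lemma isomorphic_dim W X Y :
  isomorphic X Y -> dim (hom W X) = dim (hom W Y).
Proof.
case=> f; apply/eqP; rewrite eqn_leq; apply/andP; split.
  by apply: (dim_leq_injective (comp_linear_r (isof f))); exact: iso_monic.
apply: (dim_leq_injective (comp_linear_r (isoV f))).
exact: (@iso_monic _ _ (iso_inv f)).
Qed.

End LinearCategories.

Section DirectSums.
Variables (K : fieldType) (C : linear_category K).
Implicit Types W X : C.

Lemma dim_hom_from_sum n (S : 'I_n -> C) W X : direct_sum S X ->
  dim (hom W X) = (\sum_k dim (hom W (S k)))%N.
Proof.
case=> inj [prj [injK orth sumE]].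
apply: (@dim_biproduct _ _ _ _
    (fun k (f : hom W (S k)) => inj k ∘ f)
  (fun k (f : hom W X) => prj k ∘ f)) => [k|k|k f|k l kl f|f].
- exact: comp_linear_r.
- exact: comp_linear_r.
- by rewrite compA injK comp1m.
- by rewrite compA orth // comp0m.
- by under eq_bigr do rewrite compA; rewrite -compm_suml sumE comp1m.
Qed.

Lemma dim_hom_to_sum n (S : 'I_n -> C) W X : direct_sum S X ->
  dim (hom X W) = (\sum_k dim (hom (S k) W))%N.
Proof.
case=> inj [prj [injK orth sumE]].
apply: (@dim_biproduct _ _ _ _
    (fun k (f : hom (S k) W) => f ∘ prj k)
  (fun k (f : hom X W) => f ∘ inj k)) => [k|k|k f|k l kl f|f].
- exact: comp_linear_l.
- exact: comp_linear_l.
- by rewrite -compA injK compm1.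
- by rewrite -compA orth 1?eq_sym // compm0.
- by under eq_bigr do rewrite -compA; rewrite -compm_sumr sumE compm1.
Qed.

End DirectSums.

(** * Schur's lemma and multiplicities *)

Section Schur.
Variables (K : numClosedFieldType) (C : linear_category K).
Hypothesis abC : abelian_category C.
Implicit Types X Y : C.

Lemma simple_idm_neq0 X : simple_object X -> idm X != 0.
Proof. by case=> nz _; apply/eqP => /zero_objectP. Qed.

(** The kernel of f is a subobject of the simple object X, and it is not all of
    X, so f is monic; being then a nonzero subobject of Y, it is invertible. *)
Lemma nonzero_is_iso X Y (f : hom X Y) :
  simple_object X -> simple_object Y -> f != 0 -> is_iso f.
Proof.
move=> [nzX simX] [nzY simY] f_neq0; have [_ [kerC _ _ _]] := abC.
have [Z [k [fk0 kP]]] := kerC _ _ f.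
have mono_k : is_mono k.
  move=> W g h kgh; have [|u [_ u_uniq]] := kP W (k ∘ g).
    by rewrite compA fk0 comp0m.
  by rewrite -(u_uniq g) // -(u_uniq h).
case: (simX _ k mono_k) => [Z0|[k' [_ kk']]]; last first.
  by case/eqP: f_neq0; rewrite -[f]compm1 -kk' compA fk0 comp0m.
have mono_f : is_mono f.
  move=> W g h /eqP; rewrite -subr_eq0 => /eqP fgh; apply/eqP; rewrite -subr_eq0.
  have [|u [<- _]] := kP W (g - h).
    by rewrite (linB (comp_linear_r f)).
  by have [_ /(_ u) ->] := Z0 W; rewrite compm0.
by have [/nzX|] := simY _ _ mono_f.
Qed.

(** Composition with f on the finite dimensional space End(X) has an eigenvector
    u for some eigenvalue a; u is invertible, and f u = a u gives f = a. *)
Lemma simple_endo_scalar X (f : hom X X) :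
  simple_object X -> exists a, f = a *: idm X.
Proof.
move=> simX.
have e_basis := vbasisP {:hom X X}.
pose L := linfun (pack_linear (comp_linear_r (X := X) f)).
have [|a /eigenvalueP[v vL v_neq0]] :=
  eigenvalue_closed (passmx.mxof (vbasis {:hom X X}) (vbasis {:hom X X}) L).
  rewrite lt0n dimv_eq0; apply: contra (simple_idm_neq0 simX) => /eqP V0.
  by rewrite -memv0 -V0 memvf.
pose u := passmx.vecof (vbasis {:hom X X}) v.
have u_neq0 : u != 0 by rewrite passmx.vecof_eq0.
have fu : f ∘ u = a *: u.
  have : L u = a *: u.
    by rewrite (passmx.hom_vecof _ e_basis) vL (linZ (passmx.vecof_linear _)).
  by rewrite lfunE.
have [w [_ uw]] := nonzero_is_iso simX simX u_neq0.
exists a; rewrite -[f]compm1 -uw compA fu.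
exact: (linZ (comp_linear_l w)).
Qed.

Lemma dim_hom_simple X Y : simple_object X -> simple_object Y ->
  dim (hom X Y) = `[< isomorphic X Y >].
Proof.
move=> simX simY; case: asboolP => [iso_XY|not_iso].
  rewrite -(isomorphic_dim X iso_XY).
  suff -> : dim (hom X X) = \dim <[idm X]> by rewrite dim_vline simple_idm_neq0.
  rewrite -dimvf; congr (\dim _).
  apply/vspaceP => g; rewrite memvf; apply/esym/vlineP.
  by have [a ->] := simple_endo_scalar g simX; exists a.
apply/eqP/dim_eq0P => f; apply/eqP; apply: contra_notT not_iso => f_neq0.
exact: is_iso_isomorphic (nonzero_is_iso simX simY f_neq0).
Qed.

End Schur.

Section Multiplicities.
Variables (K : numClosedFieldType) (C : fusion_category K).
Implicit Types X Y : C.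

Lemma decompP X : (forall k, simple_object (@decomp _ _ X k)) /\
  direct_sum (@decomp _ _ X) X.
Proof. exact: svalP (cid (svalP (cid (fusion_semisimple X)))). Qed.

Lemma multiplicityE X i :
  multiplicity X i = (\sum_k `[< isomorphic (@decomp _ _ X k) (irr i) >])%N.
Proof.
by rewrite /multiplicity -sum1dep_card big_mkcond; apply: eq_bigr => k _; case: ifP.
Qed.

Lemma dim_hom_irr X i : dim (hom (irr i) X) = multiplicity X i.
Proof.
have [sim_dec sumX] := decompP X.
rewrite (dim_hom_from_sum _ sumX) multiplicityE; apply: eq_bigr => k _.
rewrite (dim_hom_simple (fusion_abelian C)) //; last exact: irr_simple.
by congr (nat_of_bool _); apply: asbool_equiv_eq; split=> /isomorphic_sym.
Qed.

Lemma dim_hom_to_irr X i : dim (hom X (irr i)) = multiplicity X i.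
Proof.
have [sim_dec sumX] := decompP X.
rewrite (dim_hom_to_sum _ sumX) multiplicityE; apply: eq_bigr => k _.
by rewrite (dim_hom_simple (fusion_abelian C)) //; exact: irr_simple.
Qed.

End Multiplicities.

(** * Linear functors *)

Record linear_functor (K : fieldType) (C D : linear_category K) :=
    LinearFunctor {
  lobj :> C -> D;
  lmap : forall X Y : C, hom X Y -> hom (lobj X) (lobj Y);
  lmap_linear : forall X Y, linear (@lmap X Y);
  lmap1 : forall X, lmap (idm X) = idm (lobj X);
  lmap_comp : forall X Y Z (g : hom Y Z) (f : hom X Y),
    lmap (g ∘ f) = lmap g ∘ lmap f
}.

Section LinearFunctors.
Variables (K : fieldType) (C D : linear_category K) (Phi : linear_functor C D).

Lemma linear_functor_isomorphic X Y :
  isomorphic X Y -> isomorphic (Phi X) (Phi Y).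
Proof.
case=> f; split; exists (lmap Phi (isof f)) (lmap Phi (isoV f)).
  by rewrite -lmap_comp isofK lmap1.
by rewrite -lmap_comp isoVK lmap1.
Qed.

Lemma linear_functor_direct_sum n (S : 'I_n -> C) X :
  direct_sum S X -> direct_sum (fun k => Phi (S k)) (Phi X).
Proof.
case=> inj [prj [injK orth sumE]].
exists (fun k => lmap Phi (inj k)), (fun k => lmap Phi (prj k)); split.
- by move=> k; rewrite -lmap_comp injK lmap1.
- by move=> k l kl; rewrite -lmap_comp orth // (lin0 (@lmap_linear _ _ _ Phi _ _)).
- rewrite -lmap1 -sumE (lin_sum (@lmap_linear _ _ _ Phi _ _)).
  by apply: eq_bigr => k _; rewrite lmap_comp.
Qed.

End LinearFunctors.

(** Functors preserve the decomposition of X into simple objects; the summands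
    are then counted by isomorphism class. *)
Lemma dim_hom_functor (K : numClosedFieldType) (C : fusion_category K)
    (D : linear_category K) (Phi : linear_functor C D) (W : D) (X : C) :
  dim (hom W (Phi X)) =
    (\sum_i multiplicity X i * dim (hom W (Phi (irr i))))%N.
Proof.
have [sim_dec sumX] := decompP X.
rewrite (dim_hom_from_sum _ (linear_functor_direct_sum Phi sumX)).
under [RHS]eq_bigr do rewrite multiplicityE big_distrl.
rewrite exchange_big; apply: eq_bigr => k _ /=.
have [j iso_j] := irr_complete (sim_dec k).
rewrite (bigD1 j) //= big1 ?addn0 => [|i i_neq_j].
  by rewrite asboolT // mul1n; apply/isomorphic_dim/linear_functor_isomorphic.
rewrite asboolF // => iso_i; case/eqP: i_neq_j; apply: irr_inj.
exact: isomorphic_trans (isomorphic_sym iso_i) iso_j.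
Qed.

(** * Duality in tensor categories *)

Section TensorCategories.
Variables (K : fieldType) (C : tensor_category K).
Implicit Types W X Y Z : C.

Definition tens_right (Y : C) : linear_functor C C.
Proof.
exists (fun X => X ⊗ Y) (fun X X' f => f ⊠ idm Y).
- by move=> X X'; exact: tens_linear_l.
- by move=> X; exact: tens1m.
- by move=> X X' X'' g f; rewrite -tens_comp comp1m.
Defined.

Definition tens_left (X : C) : linear_functor C C.
Proof.
exists (fun Y => X ⊗ Y) (fun Y Y' f => idm X ⊠ f).
- by move=> Y Y'; exact: tens_linear_r.
- by move=> Y; exact: tens1m.
- by move=> Y Y' Y'' g f; rewrite -tens_comp comp1m.
Defined.

Lemma tens_idl_comp X Y Y' Y'' (g : hom Y' Y'') (f : hom Y Y') :
  idm X ⊠ (g ∘ f) = (idm X ⊠ g) ∘ (idm X ⊠ f).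
Proof. exact: (lmap_comp (tens_left X)). Qed.

Lemma tens_idr_comp X X' X'' Y (g : hom X' X'') (f : hom X X') :
  (g ∘ f) ⊠ idm Y = (g ⊠ idm Y) ∘ (f ⊠ idm Y).
Proof. exact: (lmap_comp (tens_right Y)). Qed.

Lemma tens_exchange X X' Y Y' (f : hom X X') (g : hom Y Y') :
  (f ⊠ idm Y') ∘ (idm X ⊠ g) = (idm X' ⊠ g) ∘ (f ⊠ idm Y).
Proof. by rewrite -!tens_comp !comp1m !compm1. Qed.

Lemma tens0l X X' Y Y' (g : hom Y Y') : (0 : hom X X') ⊠ g = 0.
Proof. exact: (lin0 (tens_linear_l g)). Qed.

Lemma tens0r X X' Y Y' (f : hom X X') : f ⊠ (0 : hom Y Y') = 0.
Proof. exact: (lin0 (tens_linear_r f)). Qed.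

(** Rewrites an equality of composites inside a longer composite that
    associates to the right. *)
Lemma comp_eq_precomp V X Y Y' Z (g : hom Y Z) (f : hom X Y)
    (g' : hom Y' Z) (f' : hom X Y') (h : hom V X) :
  g ∘ f = g' ∘ f' -> g ∘ (f ∘ h) = g' ∘ (f' ∘ h).
Proof. by rewrite !compA => ->. Qed.

Lemma iso_swap X Y X' Y' (u : iso X Y) (v : iso X' Y') (f : hom X X')
    (g : hom Y Y') :
  isof v ∘ f = g ∘ isof u -> isoV v ∘ g = f ∘ isoV u.
Proof.
by move=> vf; rewrite -[g]compm1 -(isoVK u) (compA g) -vf !compA isofK comp1m.
Qed.

Lemma assocV_nat X X' Y Y' Z Z' (f : hom X X') (g : hom Y Y') (h : hom Z Z') :
  isoV (assoc X' Y' Z') ∘ (f ⊠ (g ⊠ h)) =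
  ((f ⊠ g) ⊠ h) ∘ isoV (assoc X Y Z).
Proof. exact/iso_swap/assoc_nat. Qed.

Lemma lunitV_nat X X' (f : hom X X') :
  isoV (lunit X') ∘ f = (idm tunit ⊠ f) ∘ isoV (lunit X).
Proof. exact/iso_swap/lunit_nat. Qed.

Definition tens_iso X X' Y Y' (f : iso X X') (g : iso Y Y') :
  iso (X ⊗ Y) (X' ⊗ Y').
Proof.
exists (isof f ⊠ isof g) (isoV f ⊠ isoV g).
- by rewrite -tens_comp !isofK tens1m.
- by rewrite -tens_comp !isoVK tens1m.
Defined.

Definition id_iso X : iso X X := Iso (comp1m (idm X)) (comp1m (idm X)).

Lemma iso_shift X Y (u : iso X Y) Z (f : hom Z X) (g : hom Z Y) :
  isof u ∘ f = g -> f = isoV u ∘ g.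
Proof. by move=> <-; rewrite compA isofK comp1m. Qed.

Lemma pentagonV W X Y Z :
  isoV (assoc W X (Y ⊗ Z)) ∘ (idm W ⊠ isof (assoc X Y Z)) =
  isof (assoc (W ⊗ X) Y Z) ∘ (isoV (assoc W X Y) ⊠ idm Z) ∘
    isoV (assoc W (X ⊗ Y) Z).
Proof.
apply/esym/(iso_shift (u := assoc W X (Y ⊗ Z))).
apply: (iso_epic (f := assoc W (X ⊗ Y) Z)).
apply: (iso_epic (f := tens_iso (assoc W X Y) (id_iso Z))) => /=.
rewrite pentagon -!compA; congr (_ ∘ _).
by rewrite (compA (isoV _) (isof _)) isofK comp1m -tens_comp isofK comp1m tens1m compm1.
Qed.

Lemma pentagonV2 W X Y Z :
  (idm W ⊠ isoV (assoc X Y Z)) ∘ isof (assoc W X (Y ⊗ Z)) =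
  isof (assoc W (X ⊗ Y) Z) ∘ (isof (assoc W X Y) ⊠ idm Z) ∘
    isoV (assoc (W ⊗ X) Y Z).
Proof.
apply/esym/(iso_shift (u := tens_iso (id_iso W) (assoc X Y Z))) => /=.
by rewrite !compA pentagon -compA isoVK compm1.
Qed.

Lemma triangleV X Y :
  isoV (assoc X tunit Y) ∘ (idm X ⊠ isoV (lunit Y)) = isoV (runit X) ⊠ idm Y.
Proof.
apply: (iso_monic (f := tens_iso (runit X) (id_iso Y))) => /=.
rewrite -tens_comp isoVK comp1m tens1m -triangle -!compA.
by rewrite (compA (isof _) (isoV _)) isoVK comp1m -tens_comp isoVK comp1m tens1m.
Qed.

(** The maps f |-> flat f and g |-> sharp g between Hom(X ⊗ Y, W) and
    Hom(Y, Z ⊗ W) are mutually inverse, but showing that needs the coherence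
    lunit (X ⊗ Y) ∘ assoc = lunit X ⊠ id, to be derived from the pentagon.  It is
    enough that both composites are compositions with an isomorphism: then both maps
    are injective and the dimensions agree. *)
Section Duality.
Variables (X Z : C) (ev : hom (X ⊗ Z) tunit) (coev : hom tunit (Z ⊗ X)).

Definition flat Y W (f : hom (X ⊗ Y) W) : hom Y (Z ⊗ W) :=
  (idm Z ⊠ f) ∘ (isof (assoc Z X Y) ∘ ((coev ⊠ idm Y) ∘ isoV (lunit Y))).

Definition sharp Y W (g : hom Y (Z ⊗ W)) : hom (X ⊗ Y) W :=
  isof (lunit W) ∘ ((ev ⊠ idm W) ∘ (isoV (assoc X Z W) ∘ (idm X ⊠ g))).

Lemma flat_linear Y W : linear (@flat Y W).
Proof.
by move=> a f g; rewrite /flat tens_linear_r comp_linear_l.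
Qed.

Lemma sharp_linear Y W : linear (@sharp Y W).
Proof.
by move=> a f g; rewrite /sharp tens_linear_r !comp_linear_r.
Qed.

Hypothesis zigzagX :
  isof (lunit X) ∘ (ev ⊠ idm X) ∘ isoV (assoc X Z X) ∘ (idm X ⊠ coev) =
  isof (runit X).

Lemma flatK Y W (f : hom (X ⊗ Y) W) :
  sharp (flat f) =
  f ∘ (isof (lunit (X ⊗ Y)) ∘ (isof (assoc tunit X Y) ∘
    (isoV (lunit X) ⊠ idm Y))).
Proof.
rewrite /sharp /flat !tens_idl_comp (comp_eq_precomp _ (assocV_nat _ _ f)) tens1m.
rewrite (comp_eq_precomp _ (tens_exchange ev f)).
rewrite (comp_eq_precomp _ (lunit_nat f)); congr (f ∘ (_ ∘ _)).
rewrite (comp_eq_precomp _ (pentagonV X Z X Y)) -!compA.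
rewrite (comp_eq_precomp _ (assocV_nat _ coev _)) triangleV -tens1m.
rewrite -(comp_eq_precomp _ (assoc_nat ev _ _)) -!tens_idr_comp.
congr (_ ∘ (_ ⊠ _)); apply: (iso_monic (f := lunit X)).
by rewrite isoVK !compA zigzagX isoVK.
Qed.

Hypothesis zigzagZ :
  isof (runit Z) ∘ (idm Z ⊠ ev) ∘ isof (assoc Z X Z) ∘ (coev ⊠ idm Z) =
  isof (lunit Z).

Lemma sharpK Y W (g : hom Y (Z ⊗ W)) :
  flat (sharp g) =
  (isof (lunit Z) ⊠ idm W) ∘ (isoV (assoc tunit Z W) ∘
    (isoV (lunit (Z ⊗ W)) ∘ g)).
Proof.
rewrite /sharp /flat !tens_idl_comp -!compA.
rewrite -(comp_eq_precomp _ (assoc_nat _ _ g)) tens1m.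
rewrite -(comp_eq_precomp _ (tens_exchange coev g)) -lunitV_nat.
rewrite (comp_eq_precomp _ (pentagonV2 Z X Z W)) -!compA.
rewrite -tens1m (comp_eq_precomp _ (assocV_nat coev _ _)).
rewrite -(comp_eq_precomp _ (assoc_nat _ ev _)).
rewrite (compA (idm Z ⊠ isof (lunit W))) triangle.
by rewrite -zigzagZ !tens_idr_comp !compA.
Qed.

Lemma duality_dim Y W : dim (hom (X ⊗ Y) W) = dim (hom Y (Z ⊗ W)).
Proof.
have inj_comp (A B D : Type) (f : A -> B) (g : B -> D) :
    injective (g \o f) -> injective f by move=> gf x y /(congr1 g) /gf.
apply/eqP; rewrite eqn_leq; apply/andP; split.
  apply: (dim_leq_injective (@flat_linear Y W)).
  apply: (inj_comp _ _ _ _ (@sharp Y W)) => f g /=; rewrite !flatK !compA.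
  move/(iso_epic (f := tens_iso (iso_inv (lunit X)) (id_iso Y))).
  by move/(iso_epic (f := assoc _ _ _))/(iso_epic (f := lunit _)).
apply: (dim_leq_injective (@sharp_linear Y W)).
apply: (inj_comp _ _ _ _ (@flat Y W)) => f g /=; rewrite !sharpK.
move/(iso_monic (f := tens_iso (lunit Z) (id_iso W))).
move/(iso_monic (f := iso_inv (assoc _ _ _))).
by move/(iso_monic (f := iso_inv (lunit _))).
Qed.

End Duality.
Lemma dim_hom_dual X Z Y W : dual_pair X Z ->
  dim (hom (X ⊗ Y) W) = dim (hom Y (Z ⊗ W)).
Proof. by case=> ev [coev [zigX zigZ]]; exact: duality_dim zigZ zigX Y W. Qed.

(** If the evaluation vanished, the zigzag identity would equate a unitor with 0
    and force X to be zero. *)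
Lemma dual_ev_neq0l X Z (nzX : idm X != 0) : dual_pair Z X ->
  exists ev : hom (Z ⊗ X) tunit, ev != 0.
Proof.
case=> ev [coev [zig _]]; exists ev; apply: contra nzX => /eqP ev0.
by rewrite -(isoVK (lunit X)) -zig ev0 tens0r compm0 !comp0m.
Qed.

Lemma dual_ev_neq0r X Z (nzX : idm X != 0) : dual_pair X Z ->
  exists ev : hom (X ⊗ Z) tunit, ev != 0.
Proof.
case=> ev [coev [_ zig]]; exists ev; apply: contra nzX => /eqP ev0.
by rewrite -(isoVK (runit X)) -zig ev0 tens0l compm0 !comp0m.
Qed.

End TensorCategories.

(** * Transitivity of the tensor product of simple objects *)

Section FusionCategories.
Variables (K : numClosedFieldType) (C : fusion_category K).
Implicit Types X Y Z : C.

Lemma sum_gt0_exists n (F : 'I_n -> nat) :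
  (0 < \sum_i F i)%N -> exists i, (0 < F i)%N.
Proof.
case: (pickP (fun i => 0 < F i)%N) => [i Fi _|F0]; first by exists i.
by rewrite big1 // => i _; apply/eqP; rewrite -leqn0 leqNgt F0.
Qed.

Lemma dim_hom_gt0 (D : linear_category K) (X Y : D) (f : hom X Y) :
  f != 0 -> (0 < dim (hom X Y))%N.
Proof. by rewrite lt0n; apply: contra => /dim_eq0P/(_ f) ->. Qed.

Lemma split_epi_simple X S (f : hom X S) : simple_object S -> f != 0 ->
  exists s : hom S X, f ∘ s = idm S.
Proof.
move=> simS f_neq0; have [sim_dec [inj [prj [_ _ sumE]]]] := decompP X.
have [k fk_neq0] : exists k, f ∘ inj k != 0.
  apply/existsP; apply: contraNT f_neq0; rewrite negb_exists => /forallP fk0.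
  rewrite -[f]compm1 -sumE compm_sumr big1 // => k _.
  by rewrite compA (eqP (negbNE (fk0 k))) comp0m.
have [g [_ fg]] := nonzero_is_iso (fusion_abelian C) (sim_dec k) simS fk_neq0.
by exists (inj k ∘ g); rewrite compA.
Qed.

Lemma unit_idm_neq0 : idm (tunit : C) != 0.
Proof.
apply/eqP => id0; have /bij_inj/(_ 0 1) := fusion_End_unit C.
by rewrite /= id0 !scaler0 => /(_ erefl)/eqP; rewrite eq_sym oner_eq0.
Qed.

(** The unit is a direct sum of simple objects, and each summand gives an
    idempotent endomorphism of the unit.  As End(1) consists of scalars, a
    nonzero such idempotent is the identity, so its summand is all of the
    unit. *)
Lemma unit_irr : exists i, isomorphic (tunit : C) (irr i).
Proof.
have [sim_dec [inj [prj [injK _ sumE]]]] := decompP (tunit : C).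
have [k ek_neq0] : exists k, inj k ∘ prj k != 0.
  apply/existsP; apply: contraNT unit_idm_neq0; rewrite negb_exists => /forallP e0.
  by rewrite -sumE big1 // => k _; apply/eqP/negbNE.
have [h _ hK] := fusion_End_unit C.
pose c := h (inj k ∘ prj k); have ec : inj k ∘ prj k = c *: idm tunit by rewrite hK.
have c1 : c = 1.
  have /eqP : (inj k ∘ prj k) ∘ (inj k ∘ prj k) = inj k ∘ prj k.
    by rewrite compA -(compA (inj k)) injK compm1.
  rewrite [X in X ∘ _]ec (linZ (comp_linear_l _)) comp1m -subr_eq0.
  rewrite -[X in _ - X]scale1r -scalerBl scaler_eq0 (negPf ek_neq0) orbF.
  by rewrite subr_eq0 => /eqP.
have [i iso_i] := irr_complete (sim_dec k).
exists i; apply: isomorphic_trans iso_i; split.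
by exists (prj k) (inj k); [rewrite ec c1 scale1r | exact: injK].
Qed.

Lemma split_epi_unit X (f : hom X tunit) : f != 0 ->
  exists s : hom tunit X, f ∘ s = idm tunit.
Proof.
move=> f_neq0; have [i [u]] := unit_irr.
have [|s us] := split_epi_simple (f := isof u ∘ f) (irr_simple i).
  apply: contra f_neq0 => /eqP uf0; apply/eqP/(iso_monic (f := u)).
  by rewrite uf0 compm0.
exists (s ∘ isof u); rewrite -(isofK u) -[f]comp1m -(isofK u) -!compA.
by rewrite (compA f) (compA (isof u)) (compA (isof u) f) us comp1m.
Qed.

Lemma split_mono_neq0 (D : linear_category K) (X Y : D) (s : hom X Y)
  (f : hom Y X) : idm X != 0 -> f ∘ s = idm X -> s != 0.
Proof. by move=> nz fs; apply: contra nz => /eqP s0; rewrite -fs s0 compm0. Qed.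

Lemma irr_idm_neq0 i : idm (irr i : C) != 0.
Proof. exact: simple_idm_neq0 (irr_simple i). Qed.

(** If Z is dual to irr j, the evaluation Z ⊗ irr j -> 1 splits, so that
    irr k = irr k ⊗ 1 embeds into (irr k ⊗ Z) ⊗ irr j; the simple object irr i
    is found among the constituents of irr k ⊗ Z. *)
Lemma transitive_left (j k : 'I_(rank C)) :
  exists i, (0 < multiplicity (irr i ⊗ irr j) k)%N.
Proof.
have [[Z dZ] _] := fusion_rigid (irr j : C).
have [ev /split_epi_unit[s evs]] := dual_ev_neq0l (irr_idm_neq0 j) dZ.
pose t := isoV (assoc (irr k) Z (irr j)) ∘
  ((idm (irr k) ⊠ s) ∘ isoV (runit (irr k))).
have : t != 0.
  apply: (split_mono_neq0 (f := isof (runit (irr k)) ∘ ((idm (irr k) ⊠ ev) ∘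
    isof (assoc (irr k) Z (irr j))))); first exact: irr_idm_neq0.
  rewrite /t -!compA (compA (isof (assoc _ _ _))) isoVK comp1m.
  by rewrite (compA (_ ⊠ ev)) -tens_idl_comp evs tens1m comp1m isoVK.
move/dim_hom_gt0; rewrite (dim_hom_functor (tens_right (irr j))) /=.
case/sum_gt0_exists => i; rewrite muln_gt0 dim_hom_irr => /andP[_ gt0].
by exists i.
Qed.

Lemma transitive_right (j k : 'I_(rank C)) :
  exists i, (0 < multiplicity (irr j ⊗ irr i) k)%N.
Proof.
have [_ [Z dZ]] := fusion_rigid (irr j : C).
have [ev /split_epi_unit[s evs]] := dual_ev_neq0r (irr_idm_neq0 j) dZ.
pose t := isof (assoc (irr j) Z (irr k)) ∘
  ((s ⊠ idm (irr k)) ∘ isoV (lunit (irr k))).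
have : t != 0.
  apply: (split_mono_neq0 (f := isof (lunit (irr k)) ∘ ((ev ⊠ idm (irr k)) ∘
    isoV (assoc (irr j) Z (irr k))))); first exact: irr_idm_neq0.
  rewrite /t -!compA (compA (isoV (assoc _ _ _))) isofK comp1m.
  by rewrite (compA (ev ⊠ _)) -tens_idr_comp evs tens1m comp1m isoVK.
move/dim_hom_gt0; rewrite (dim_hom_functor (tens_left (irr j))) /=.
case/sum_gt0_exists => i; rewrite muln_gt0 dim_hom_irr => /andP[_ gt0].
by exists i.
Qed.

End FusionCategories.


(** * The Grothendieck ring *)

Lemma linear_ext (K : fieldType) n (V : vectType K) (f g : 'rV[K]_n -> V) :
    linear f -> linear g ->
  (forall i, f (delta_mx 0 i) = g (delta_mx 0 i)) -> f =1 g.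
Proof.
move=> lf lg fg v; rewrite [v]row_sum_delta (lin_sum lf) (lin_sum lg).
by apply: eq_bigr => i _; rewrite (linZ lf) (linZ lg) fg.
Qed.

Section GrothendieckRing.
Variables (R : realType) (C : fusion_category R[i]).
Implicit Types (X Y Z : C) (u v w : 'rV[R]_(rank C)).

Lemma groth_class_isomorphic X Y :
  isomorphic X Y -> groth_class X = groth_class Y.
Proof.
by move=> isoXY; apply/rowP => i; rewrite !mxE -!dim_hom_irr (isomorphic_dim _ isoXY).
Qed.

Lemma groth_class_irr i : groth_class (irr i : C) = delta_mx 0 i.
Proof.
apply/rowP => k; rewrite !mxE eqxx /= -dim_hom_irr.
rewrite (dim_hom_simple (fusion_abelian C)); try exact: irr_simple.
congr (nat_of_bool _)%:R; apply/asboolP/eqP => [/irr_inj //|->].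
exact: isomorphic_refl.
Qed.

Lemma groth_mul_linear_r u : linear (groth_mul u).
Proof.
move=> a v w; rewrite /groth_mul scaler_sumr -big_split /=; apply: eq_bigr => i _.
rewrite scaler_sumr -big_split /=; apply: eq_bigr => j _.
by rewrite !mxE scalerA -scalerDl mulrDr mulrCA.
Qed.

Lemma groth_mul_linear_l w : linear (fun v => groth_mul v w).
Proof.
move=> a u v; rewrite /groth_mul scaler_sumr -big_split /=; apply: eq_bigr => i _.
rewrite scaler_sumr -big_split /=; apply: eq_bigr => j _.
by rewrite !mxE scalerA -scalerDl mulrDl mulrA.
Qed.

(** The class of Phi X depends linearly on the class of X, for any linear functor
    Phi.  For - ⊗ Y and X ⊗ - this is the multiplicativity of classes, for a
    tensor functor the identity [F X] = F [X]. *)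
Lemma groth_class_functor (D : fusion_category R[i]) (Phi : linear_functor D C)
    (X : D) :
  groth_class (Phi X) =
    \sum_i (multiplicity X i)%:R *: groth_class (Phi (irr i)).
Proof.
apply/rowP => k; rewrite mxE summxE -dim_hom_irr dim_hom_functor natr_sum.
by apply: eq_bigr => i _; rewrite natrM dim_hom_irr !mxE.
Qed.

Lemma groth_class_tens X Y :
  groth_class (X ⊗ Y) = groth_mul (groth_class X) (groth_class Y).
Proof.
rewrite (groth_class_functor (tens_right Y)); apply: eq_bigr => i _ /=.
rewrite (groth_class_functor (tens_left (irr i))) scaler_sumr.
by apply: eq_bigr => j _ /=; rewrite scalerA !mxE.
Qed.

Lemma groth_mulA u v w :
  groth_mul u (groth_mul v w) = groth_mul (groth_mul u v) w.
Proof.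
apply: (linear_ext (f := fun u => groth_mul u (groth_mul v w))
  (g := fun u => groth_mul (groth_mul u v) w)) => [|a x y|i].
- exact: groth_mul_linear_l.
- by rewrite !groth_mul_linear_l.
apply: (linear_ext (f := fun v => groth_mul (delta_mx 0 i) (groth_mul v w))
  (g := fun v => groth_mul (groth_mul (delta_mx 0 i) v) w)) => [a x y|a x y|j].
- by rewrite groth_mul_linear_l groth_mul_linear_r.
- by rewrite groth_mul_linear_r groth_mul_linear_l.
apply: (linear_ext
  (f := fun w => groth_mul (delta_mx 0 i) (groth_mul (delta_mx 0 j) w))) => [a x y||k].
- by rewrite !groth_mul_linear_r.
- exact: groth_mul_linear_r.
rewrite -!groth_class_irr -!groth_class_tens.
by apply/esym/groth_class_isomorphic; split; exact: assoc.
Qed.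

Lemma mul_mul_matrix v X : v *m mul_matrix X = groth_mul (groth_class X) v.
Proof.
exact: (mul_rV_lin1 (pack_linear (groth_mul_linear_r (groth_class X)))).
Qed.

Lemma mul_matrixE X j k : mul_matrix X j k = (multiplicity (X ⊗ irr j) k)%:R.
Proof. by rewrite mxE -groth_class_irr -groth_class_tens mxE. Qed.

(** The entries are the multiplicities of irr j in Z ⊗ irr k and of irr k in
    X ⊗ irr j.  Reading the first as dimensions of Hom-spaces out of irr j and
    the second as dimensions of Hom-spaces into irr k, duality equates them. *)
Lemma mul_matrix_dual X Z : dual_pair X Z -> mul_matrix Z = (mul_matrix X)^T.
Proof.
move=> dXZ; apply/matrixP => k j; rewrite [RHS]mxE !mul_matrixE.
by rewrite -dim_hom_irr -(dim_hom_dual _ _ dXZ) dim_hom_to_irr.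
Qed.

Lemma rank_gt0 : (0 < rank C)%N.
Proof. by have [i _] := unit_irr C; exact: leq_ltn_trans (leq0n i) (ltn_ord i). Qed.

(** * Frobenius-Perron dimensions *)

(** By [eigenvalue_le] the eigenvalue of a positive eigenvector is the largest
    one.  When it is 0 there is no positive eigenvalue, and the supremum of the
    empty set is 0 as well. *)
Lemma FPdimE X (r : 'rV[R]_(rank C)) c :
    (forall i, 0 < r 0 i) -> groth_mul (groth_class X) r = c *: r ->
  FPdim X = c.
Proof.
move=> r_gt0 Xr; have rM : r *m mul_matrix X = c *: r by rewrite mul_mul_matrix.
have i0 := Ordinal rank_gt0.
have r_neq0 : r != 0.
  by apply/eqP => r0; have := r_gt0 i0; rewrite r0 mxE ltxx.
have M_ge0 i j : 0 <= mul_matrix X i j by rewrite mul_matrixE ler0n.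
have le_c a : eigenvalue (mul_matrix X) a -> a <= c.
  by case/eigenvalueP => v vM v_neq0; exact: eigenvalue_le M_ge0 r_gt0 rM v_neq0 vM.
have c_eig : eigenvalue (mul_matrix X) c by apply/eigenvalueP; exists r.
have c_ge0 : 0 <= c.
  rewrite -(pmulr_lge0 _ (r_gt0 i0)); have /rowP/(_ i0) := rM.
  rewrite [in RHS]mxE => <-; rewrite mxE sumr_ge0 // => j _.
  by rewrite mulr_ge0 // ltW.
rewrite /FPdim; move: c_ge0; rewrite le_eqVlt => /predU1P[c0|c_gt0].
  rewrite (_ : [set _ | _]%classic = set0) ?sup0 //.
  by apply/seteqP; split => // a [a_gt0 /le_c]; rewrite -c0 leNgt a_gt0.
apply/eqP; rewrite eq_le; apply/andP; split.
  by apply: ge_sup; [exists c | move=> a [_ /le_c]].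
by apply: ub_le_sup => //; exists c => a [_ /le_c].
Qed.

(** Right multiplication by the sum s of the simple objects has a positive
    matrix by [transitive_right], hence a Perron eigenvector r.  Left
    multiplications commute with it, so they preserve its eigenspace, which is
    the line of r. *)
Lemma common_eigenvector : exists r : 'rV[R]_(rank C),
  (forall i, 0 < r 0 i) /\ forall u, exists c, groth_mul u r = c *: r.
Proof.
pose s : 'rV[R]_(rank C) := \sum_i delta_mx 0 i.
pose M := lin1_mx (fun v => groth_mul v s).
have vM v : v *m M = groth_mul v s.
  exact: (mul_rV_lin1 (pack_linear (groth_mul_linear_l s))).
have M_gt0 j k : 0 < M j k.
  rewrite mxE (lin_sum (groth_mul_linear_r _)) summxE.
  have [i i_gt0] := transitive_right j k.
  rewrite (bigD1 i) //= -!groth_class_irr -groth_class_tens mxE ltr_pwDl ?ltr0n //.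
  by apply: sumr_ge0 => l _; rewrite -groth_class_irr -groth_class_tens mxE ler0n.
have [r [a [r_gt0 rM]]] := perron_exists rank_gt0 M_gt0.
exists r; split=> // u; apply: (positive_eigenvector_unique M_gt0 r_gt0 rM).
by rewrite vM -groth_mulA -vM rM (linZ (groth_mul_linear_r u)).
Qed.

Definition fpdim_ext v : R := \sum_i v 0 i * FPdim (irr i : C).

Lemma fpdim_ext_linear : linear (fpdim_ext : _ -> R^o).
Proof.
move=> a u v; rewrite /fpdim_ext scaler_sumr -big_split /=.
by apply: eq_bigr => i _; rewrite !mxE mulrDl -mulrA.
Qed.

Lemma fpdim_ext_delta i : fpdim_ext (delta_mx 0 i) = FPdim (irr i : C).
Proof.
rewrite /fpdim_ext (bigD1 i) //= mxE !eqxx mul1r big1 ?addr0 // => j /negPf ji.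
by rewrite mxE ji andbF mul0r.
Qed.

Lemma FP_eigenvector : exists r : 'rV[R]_(rank C),
  (forall i, 0 < r 0 i) /\ forall u, groth_mul u r = fpdim_ext u *: r.
Proof.
have [r [r_gt0 r_eig]] := common_eigenvector; exists r; split=> //.
apply: (linear_ext (f := fun u => groth_mul u r)) => [|a u v|i].
- exact: groth_mul_linear_l.
- by rewrite fpdim_ext_linear scalerDl scalerA.
have [c cE] := r_eig (delta_mx 0 i).
by rewrite fpdim_ext_delta cE (FPdimE r_gt0 (c := c)) // groth_class_irr.
Qed.

Lemma scaler_row_inj (r : 'rV[R]_(rank C)) a b :
  (forall i, 0 < r 0 i) -> a *: r = b *: r -> a = b.
Proof.
move=> r_gt0 /rowP/(_ (Ordinal rank_gt0)); rewrite !mxE.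
by apply: mulIf; rewrite gt_eqF.
Qed.

Lemma fpdim_ext_class X : fpdim_ext (groth_class X) = FPdim X.
Proof.
have [r [r_gt0 r_eig]] := FP_eigenvector.
by rewrite (FPdimE r_gt0 (r_eig (groth_class X))).
Qed.

(** The eigenvalue of u on a fixed eigenvector is multiplicative in u. *)
Lemma fpdim_ext_mul u v :
  fpdim_ext (groth_mul u v) = fpdim_ext u * fpdim_ext v.
Proof.
have [r [r_gt0 r_eig]] := FP_eigenvector; apply: (scaler_row_inj r_gt0).
rewrite -r_eig -groth_mulA r_eig (linZ (groth_mul_linear_r u)) r_eig scalerA.
by rewrite mulrC.
Qed.

Lemma FPdim_irr_gt0 i : 0 < FPdim (irr i : C).
Proof.
have [r [r_gt0 r_eig]] := FP_eigenvector.
pose k := Ordinal rank_gt0.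
rewrite -fpdim_ext_delta -(pmulr_lgt0 _ (r_gt0 k)).
have /rowP/(_ k) := r_eig (delta_mx 0 i); rewrite [in RHS]mxE => <-.
rewrite -groth_class_irr -mul_mul_matrix mxE.
have [j j_gt0] := transitive_right i k.
rewrite (bigD1 j) //= ltr_pwDl //; first by rewrite mulr_gt0 // mul_matrixE ltr0n.
by apply: sumr_ge0 => l _; rewrite mulr_ge0 // ?mul_matrixE ?ler0n // ltW.
Qed.

Lemma regular_objectE i : regular_object C 0 i = FPdim (irr i : C).
Proof.
rewrite /regular_object summxE (bigD1 i) //= big1 ?addr0 => [|j ji].
  by rewrite groth_class_irr !mxE !eqxx mulr1.
by rewrite groth_class_irr !mxE eq_sym (negPf ji) andbF mulr0.
Qed.

Lemma regular_object_gt0 i : 0 < regular_object C 0 i.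
Proof. by rewrite regular_objectE FPdim_irr_gt0. Qed.

(** Multiplication by X is the transpose of multiplication by a dual Z, for which
    the dimensions form an eigenvector because FPdim is a character:
    the sum over j of [Z ⊗ irr k : irr j] FPdim (irr j) is FPdim Z FPdim (irr k).
    This gives the eigenvalue FPdim Z; the eigenvector being positive, the
    eigenvalue is also FPdim X. *)
Lemma regular_object_eigen X :
  groth_mul (groth_class X) (regular_object C) = FPdim X *: regular_object C.
Proof.
have [[Z dZX] _] := fusion_rigid X.
have eigZ : groth_mul (groth_class X) (regular_object C) =
    FPdim Z *: regular_object C.
  apply/rowP => k; rewrite -mul_mul_matrix (mul_matrix_dual dZX) !mxE.
  rewrite regular_objectE -!fpdim_ext_class -fpdim_ext_mul.
  rewrite -groth_class_tens; apply: eq_bigr => j _.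
  by rewrite regular_objectE !mxE -mul_matrixE mulrC mxE.
by rewrite eigZ (FPdimE regular_object_gt0 eigZ).
Qed.

Lemma fpdim_regular_object : fpdim_ext (regular_object C) = FPdim_cat C.
Proof. by apply: eq_bigr => i _; rewrite regular_objectE expr2. Qed.

Lemma FPdim_cat_gt0 : 0 < FPdim_cat C.
Proof.
rewrite /FPdim_cat (bigD1 (Ordinal rank_gt0)) //= ltr_pwDl ?exprn_gt0 ?FPdim_irr_gt0 //.
by apply: sumr_ge0 => i _; rewrite sqr_ge0.
Qed.

End GrothendieckRing.

(** * Surjective tensor functors *)

Definition underlying_functor (K : fieldType) (C D : tensor_category K)
    (F : tensor_functor C D) : linear_functor C D :=
  LinearFunctor (fmap_linear F) (fmap1 F) (fmap_comp F).

Section TensorFunctors.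
Variables (R : realType) (C D : fusion_category R[i]) (F : tensor_functor C D).

Lemma groth_map_linear : linear (groth_map F).
Proof.
move=> a u v; rewrite /groth_map scaler_sumr -big_split /=; apply: eq_bigr => i _.
by rewrite !mxE scalerA -scalerDl.
Qed.

Lemma groth_map_class X : groth_map F (groth_class X) = groth_class (F X).
Proof.
rewrite (groth_class_functor (underlying_functor F)).
by apply: eq_bigr => i _; rewrite mxE.
Qed.

Lemma groth_map_mul u v :
  groth_map F (groth_mul u v) = groth_mul (groth_map F u) (groth_map F v).
Proof.
apply: (linear_ext (f := fun u => groth_map F (groth_mul u v))
  (g := fun u => groth_mul (groth_map F u) (groth_map F v))) => [a x y|a x y|i].
- by rewrite groth_mul_linear_l groth_map_linear.
- by rewrite groth_map_linear groth_mul_linear_l.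
apply: (linear_ext (f := fun v => groth_map F (groth_mul (delta_mx 0 i) v))
  (g := fun v => groth_mul (groth_map F (delta_mx 0 i)) (groth_map F v)))
    => [a x y|a x y|j].
- by rewrite groth_mul_linear_r groth_map_linear.
- by rewrite groth_map_linear groth_mul_linear_r.
rewrite -!groth_class_irr -groth_class_tens !groth_map_class -groth_class_tens.
by apply/esym/groth_class_isomorphic; split; exact: ften.
Qed.

Lemma groth_map_regular_eigen X :
  groth_mul (groth_class (F X)) (groth_map F (regular_object C)) =
    FPdim X *: groth_map F (regular_object C).
Proof.
by rewrite -groth_map_class -groth_map_mul regular_object_eigen (linZ groth_map_linear).
Qed.

Hypothesis F_surj : surjective_functor F.

Lemma surjective_irr k : exists i, (0 < multiplicity (F (irr i)) k)%N.
Proof.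
have [T [m mono_m]] := F_surj (irr_simple k).
have m_neq0 : m != 0.
  apply: contra (irr_idm_neq0 k) => /eqP m0; apply/eqP/mono_m.
  by rewrite m0 !comp0m.
have := dim_hom_gt0 m_neq0; rewrite (dim_hom_functor (underlying_functor F)) /=.
case/sum_gt0_exists => i; rewrite muln_gt0 dim_hom_irr => /andP[_ gt0].
by exists i.
Qed.

Lemma groth_map_regular_gt0 k : 0 < groth_map F (regular_object C) 0 k.
Proof.
rewrite /groth_map summxE; have [i i_gt0] := surjective_irr k.
have ge0 j : 0 <= regular_object C 0 j by rewrite ltW ?regular_object_gt0.
rewrite (bigD1 i) //= ltr_pwDl //.
  by rewrite !mxE mulr_gt0 ?regular_object_gt0 ?ltr0n.
by apply: sumr_ge0 => j _; rewrite mxE mulr_ge0 // mxE ler0n.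
Qed.

(** FPdim X is the eigenvalue of F X on a positive eigenvector, the image of the
    regular object. *)
Lemma FPdim_functor X : FPdim (F X) = FPdim X.
Proof. exact: FPdimE groth_map_regular_gt0 (groth_map_regular_eigen X). Qed.

Lemma sum_mul_matrix_gt0 j l : 0 < (\sum_i mul_matrix (F (irr i))) j l.
Proof.
have [k k_gt0] := transitive_left j l; have [i i_gt0] := surjective_irr k.
rewrite summxE (bigD1 i) //= ltr_pwDl //; last first.
  by apply: sumr_ge0 => i' _; rewrite mul_matrixE ler0n.
rewrite mul_matrixE ltr0n -dim_hom_irr (dim_hom_functor (tens_right (irr j))) /=.
by rewrite (bigD1 k) //= addn_gt0 muln_gt0 i_gt0 dim_hom_irr k_gt0.
Qed.

(** Both sides are eigenvectors of the sum of the operators F X, for X simple,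
    with eigenvalue the sum of the FPdim X. *)
Lemma regular_object_proportional :
  exists c, groth_map F (regular_object C) = c *: regular_object D.
Proof.
apply: (positive_eigenvector_unique sum_mul_matrix_gt0 (@regular_object_gt0 _ D)
  (a := \sum_i FPdim (irr i : C))).
- rewrite mulmx_sumr scaler_suml; apply: eq_bigr => i _.
  by rewrite mul_mul_matrix regular_object_eigen FPdim_functor.
- rewrite mulmx_sumr scaler_suml; apply: eq_bigr => i _.
  by rewrite mul_mul_matrix groth_map_regular_eigen.
Qed.

Lemma fpdim_groth_map u : fpdim_ext (groth_map F u) = fpdim_ext u.
Proof.
rewrite (lin_sum (@fpdim_ext_linear _ D)); apply: eq_bigr => i _.
by rewrite (linZ (@fpdim_ext_linear _ D)) fpdim_ext_class FPdim_functor.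
Qed.

End TensorFunctors.

Theorem proposition8p8 (R : realType) (C D : fusion_category R[i])
    (F : tensor_functor C D) (F_surj : surjective_functor F) :
  groth_map F (regular_object C) =
    (FPdim_cat C / FPdim_cat D) *: regular_object D.
Proof.
have [c Fc] := regular_object_proportional F_surj.
rewrite Fc -(fpdim_regular_object C) -(fpdim_groth_map F_surj) Fc.
rewrite (linZ (@fpdim_ext_linear _ D)) fpdim_regular_object.
by rewrite mulfK // gt_eqF ?FPdim_cat_gt0.
Qed.
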